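(* Let $d\ge2$, let $F_d$ be the free group on $d$ generators, let $\lambda$ be the symmetric uniform probability measure on the free generators of $F_d$ and their inverses (each of these $2d$ elements has mass $\frac1{2d}$), and let $f:(0,\infty)\to\mathbb{R}$ be a smooth strictly convex function with $f(1)=0$. Then $$I_{\lambda,f}(F_d)=\frac{2d-1}{2d}\,f\!\left(\frac{1}{2d-1}\right)+\frac{1}{2d}\,f(2d-1).$$
   Context: For probability measures $\eta,m$ in the same measure class on a measurable space $X$, the $f$-divergence is $D_f(\eta\|m):=\int_X f\left(\frac{d\eta}{dm}\right)dm$, with value $+\infty$ if $f(\frac{d\eta}{dm})\notin L^1(m)$; it is non-negative. A group $G$ acts on itself by left translation and $(g\eta)(x)=\eta(g^{-1}x)$. For a fully supported probability measure $\eta$ on $G$, $h_{\lambda,f}(G,\eta):=\sum_{g\in G}\lambda(g)D_f(g\eta\|\eta)$, and $I_{\lambda,f}(G):=\inf_\eta h_{\lambda,f}(G,\eta)$, the infimum over all fully supported probability measures $\eta$ on $G$. *)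

(* Defs.v *)
From HB Require Import structures.
From mathcomp Require Import all_boot all_order all_algebra.
From mathcomp Require Import all_classical all_reals all_analysis.

Set Implicit Arguments.
Unset Strict Implicit.
Unset Printing Implicit Defensive.

Import Order.TTheory GRing.Theory Num.Theory.
Import numFieldNormedType.Exports.

Local Open Scope classical_set_scope.
Local Open Scope ring_scope.

Section Words.
Variable A : choiceType.

(* The letter (a, true) stands for a and (a, false) for its inverse. *)
Definition letter : Type := (A * bool)%type.

Definition letter_inv (x : letter) : letter := (x.1, ~~ x.2).

Definition reduced (w : seq letter) : bool :=
  sorted (fun x y => y != letter_inv x) w.

(* Prepends x and cancels it against the head when they are inverse. *)
Definition lcons (x : letter) (w : seq letter) : seq letter :=
  if w is y :: w' then if y == letter_inv x then w' else x :: w else [:: x].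

(* Reduced form of the concatenation u ++ w, for w reduced. *)
Definition word_mul (u w : seq letter) : seq letter := foldr lcons w u.

Definition word_inv (u : seq letter) : seq letter := rev (map letter_inv u).

Lemma letter_invK : involutive letter_inv.
Proof. by case=> a b; rewrite /letter_inv /= negbK. Qed.

Lemma lcons_reduced x w : reduced w -> reduced (lcons x w).
Proof.
case: w => [//|y w] /= wr; case: ifPn => [_|ne] /=; last by rewrite ne.
exact: path_sorted wr.
Qed.

Lemma word_mul_reduced u w : reduced w -> reduced (word_mul u w).
Proof. by move=> wr; elim: u => [//|x u IH] /=; exact: lcons_reduced. Qed.

Lemma lconsK x w : reduced w -> lcons (letter_inv x) (lcons x w) = w.
Proof.
case: w => [_|y w wr] /=; first by rewrite letter_invK eqxx.
case: ifPn => [/eqP yx|_] /=; last by rewrite letter_invK eqxx.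
subst y; case: w wr => [//|z w] /= /andP[zx _].
by rewrite (negPf zx).
Qed.

Lemma lconsVK x w : reduced w -> lcons x (lcons (letter_inv x) w) = w.
Proof. by move=> /(lconsK (letter_inv x)); rewrite letter_invK. Qed.

Lemma word_mul_nil u : reduced u -> word_mul u [::] = u.
Proof.
elim: u => [//|x u IH] /= xu; rewrite IH; last exact: path_sorted xu.
by case: u {IH} xu => [//|y u] /= /andP[/negPf->].
Qed.

Lemma word_mul_lcons x u w : reduced w ->
  word_mul (lcons x u) w = lcons x (word_mul u w).
Proof.
move=> wr; case: u => [//|y u] /=; case: ifPn => [/eqP->|//].
by rewrite lconsVK// word_mul_reduced.
Qed.

Lemma word_mulA u v w : reduced w ->
  word_mul u (word_mul v w) = word_mul (word_mul u v) w.
Proof.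
by move=> wr; elim: u => [//|x u IH] /=; rewrite IH word_mul_lcons.
Qed.

Lemma word_invK : involutive word_inv.
Proof.
by move=> u; rewrite /word_inv map_rev revK -map_comp map_id_in// => x _;
   exact: letter_invK.
Qed.

Lemma word_inv_reduced u : reduced u -> reduced (word_inv u).
Proof.
rewrite /reduced /word_inv rev_sorted sorted_map; apply: sub_sorted => x y /=.
rewrite /relpre /= letter_invK; apply: contraNneq => <-.
by [].
Qed.

Lemma word_mulVK u w : reduced w -> word_mul (word_inv u) (word_mul u w) = w.
Proof.
move=> wr; elim: u => [//|x u IH] /=.
rewrite /word_inv /= rev_cons -cats1 /word_mul foldr_cat /=.
by rewrite lconsK// word_mul_reduced.
Qed.

End Words.

Record free_group (A : choiceType) :=
  FreeGroup { fg_word :> seq (letter A); _ : reduced fg_word }.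

HB.instance Definition _ A := [isSub for @fg_word A].
HB.instance Definition _ A := [Choice of free_group A by <:].

Section FreeGroup.
Variable A : choiceType.
Implicit Types u v w : free_group A.

Definition fg_one : free_group A := @FreeGroup A [::] isT.

Definition fg_mul u v : free_group A :=
  FreeGroup (word_mul_reduced u (valP v)).

Definition fg_inv u : free_group A := FreeGroup (word_inv_reduced (valP u)).

Lemma fg_mulA : associative fg_mul.
Proof. by move=> u v w; apply/val_inj/word_mulA/valP. Qed.

Lemma fg_mul1 : left_id fg_one fg_mul.
Proof. by move=> u; exact/val_inj. Qed.

Lemma fg_mulr1 : right_id fg_one fg_mul.
Proof. by move=> u; apply/val_inj/word_mul_nil/valP. Qed.

Lemma fg_mulV : left_inverse fg_one fg_inv fg_mul.
Proof.
move=> u; apply/val_inj => /=.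
by rewrite -[X in word_mul _ X](word_mul_nil (valP u)) word_mulVK.
Qed.

Lemma fg_mulrV : right_inverse fg_one fg_inv fg_mul.
Proof.
move=> u; rewrite -{1}(_ : fg_inv (fg_inv u) = u) ?fg_mulV//.
exact/val_inj/word_invK.
Qed.

HB.instance Definition _ := isGroup.Build (free_group A)
  fg_mulA fg_mul1 fg_mulr1 fg_mulV fg_mulrV.

Definition fg_gen (a : A) : free_group A := @FreeGroup A [:: (a, true)] isT.

End FreeGroup.

Definition F_ (d : nat) : groupType := free_group 'I_d.

(* Alias of T carrying the discrete sigma-algebra. *)
Definition discrete (T : Type) : Type := T.

HB.instance Definition _ (G : groupType) := Group.on (discrete G).
HB.instance Definition _ (G : groupType) := isPointed.Build (discrete G) 1%g.
HB.instance Definition _ (G : groupType) :=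
  @isMeasurable.Build default_measure_display (discrete G)
    discrete_measurable discrete_measurable0
    discrete_measurableC discrete_measurableU.

(* A real function on (0, +oo) is represented by a total function R -> R whose
   values outside (0, +oo) are irrelevant. *)
Section PositiveHalfLine.
Variable R : realType.
Implicit Type f : R -> R.

Definition smooth_on_pos f : Prop :=
  forall (n : nat) (x : R), 0 < x -> derivable (derive1n n f) x 1.

Definition strictly_convex_on_pos f : Prop :=
  forall x y t : R, 0 < x -> 0 < y -> x != y -> 0 < t -> t < 1 ->
    f (t * x + (1 - t) * y) < t * f x + (1 - t) * f y.

End PositiveHalfLine.

Section Divergence.
Context d (T : measurableType d) (R : realType).
Local Open Scope charge_scope.
Local Open Scope ereal_scope.

(* f o (d eta / d m). When eta and m are in the same measure class the density
   lies in (0, +oo) m-almost everywhere, so extending f by 0 outside (0, +oo)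
   changes neither the integrability nor the integral. *)
Definition f_density (f : R -> R) (eta m : probability T R) (x : T) : \bar R :=
  ((f \_ `]0%R, +oo[)
    (fine (('d (charge_of_finite_measure eta) '/d m) x)))%:E.

Definition f_divergence (f : R -> R) (eta m : probability T R) : \bar R :=
  if `[< m.-integrable [set: T] (f_density f eta m) >]
  then \int[m]_x f_density f eta m x else +oo.

End Divergence.

Section Translate.
Context (R : realType) (G : groupType).

Definition left_mul (g x : discrete G) : discrete G := (g * x)%g.

Lemma left_mul_measurable g : measurable_fun [set: discrete G] (left_mul g).
Proof. by []. Qed.

HB.instance Definition _ g := isMeasurableFun.Build _ _ _ _
  (left_mul g) (left_mul_measurable g).

(* (g eta)(B) = eta {x | g x \in B} = eta (g^-1 B) *)
Definition translate (g : discrete G) (eta : probability (discrete G) R)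
  : probability (discrete G) R := distribution eta (left_mul g).

Lemma translate1 (g x : discrete G) (eta : probability (discrete G) R) :
  translate g eta [set x] = eta [set (g^-1 * x)%g].
Proof.
congr (eta _); apply/seteqP; split=> y; rewrite /= /left_mul.
  by move=> <-; rewrite mulKg.
by move=> ->; rewrite mulVKg.
Qed.

End Translate.

Section FurstenbergEntropy.
Context (R : realType) (G : groupType).
Local Open Scope ereal_scope.
Implicit Types lambda eta : probability (discrete G) R.

Definition fully_supported eta : Prop := forall g : G, 0 < eta [set g].

(* For f convex with f 1 = 0 the divergences are nonnegative, as \esum
   requires; terms with lambda [set g] = 0 vanish since 0 * +oo = 0. *)
Definition h_entropy lambda (f : R -> R) eta : \bar R :=
  \esum_(g in [set: discrete G])
    (lambda [set g] * f_divergence f (translate g eta) eta).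

Definition I_entropy lambda (f : R -> R) : \bar R :=
  ereal_inf [set h_entropy lambda f eta | eta in fully_supported].

End FurstenbergEntropy.

Definition symmetric_generator (d : nat) (g : F_ d) : Prop :=
  exists i : 'I_d, g = fg_gen i \/ g = (fg_gen i : F_ d)^-1%g.

Definition symmetric_uniform (R : realType) (d : nat)
    (lambda : probability (discrete (F_ d)) R) : Prop :=
  forall g : F_ d, lambda [set g] =
    (if `[< symmetric_generator g >] then (2 * d%:R)^-1 else 0)%:E.

(* Main.v *)
(** Write q = 2d - 1 and, for a generator or inverse s, let rho_s be the density
of s eta with respect to eta, so rho_s(x) = eta(s^-1 x) / eta(x).

Lower bound: fix an end of the Cayley tree of F_d. Every vertex x has one
neighbour towards the end (its parent) and q children. Bound f(rho_s(x)) from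
below by the tangent of f at q if s^-1 x is the parent of x, and at 1/q
otherwise. After integrating against eta and summing over s, the slope terms
cancel, because each vertex is the parent of q vertices and a child of exactly
one; what remains is f(q) + q f(1/q), whatever eta is.

Upper bound: take eta_r(x) = c r^|x| with 0 < r < 1/q. Then rho_s(x) is 1/r if
the reduced word x starts with s and r otherwise, so the entropy is an explicit
function of r, which tends to the bound as r -> 1/q because eta_r(1) = c =
(1 - q r) / (1 + r) tends to 0. *)
Require Import Defs.
From HB Require Import structures.
From mathcomp Require Import all_boot all_order all_algebra.
From mathcomp Require Import all_classical all_reals all_analysis.
From mathcomp Require Import ring lra.

Set Implicit Arguments.
Unset Strict Implicit.
Unset Printing Implicit Defensive.

Import Order.TTheory GRing.Theory Num.Theory.
Import numFieldNormedType.Exports.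

Local Open Scope classical_set_scope.
Local Open Scope ring_scope.

(** * Tangent lines of convex functions, and masses as real numbers *)

(** By convexity the difference quotients of [t |-> f (x + t (y - x))] at 0 are at most [f y - f x]
    for [0 < t < 1]; their right limit, ['D_1 f x * (y - x)], inherits the bound. *)
Lemma tangent_line_le (R : realType) (f : R -> R) (x y : R) :
  strictly_convex_on_pos f -> 0 < x -> 0 < y -> derivable f x 1 ->
  f x - 'D_1 f x * x + 'D_1 f x * y <= f y.
Proof.
move=> fc x0 y0 df.
have [<-|xy] := eqVneq x y; first by rewrite subrK.
pose g t := f (x + t * (y - x)).
have dg : is_derive (0 : R) 1 g ('D_1 f x * (y - x)).
  apply: (@is_derive1_comp _ f (fun t => x + t * (y - x))).
    by rewrite mul0r addr0; exact: derivableP.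
  have -> : (fun t => x + t * (y - x)) = cst x + (y - x) \*: (@id R).
    by apply/funext => t /=; rewrite !fctE /= /GRing.scale /= mulrC.
  by apply: is_derive_eq; rewrite add0r /GRing.scale /= mulr1.
have /cvg_dnbhs_at_right : h^-1 *: (g (h *: 1 + 0) - g 0) @[h --> 0^'] -->
    'D_1 f x * (y - x).
  have := @ex_derive _ _ _ _ _ _ _ dg.
  by rewrite -(@derive_val _ _ _ _ _ _ _ dg).
move=> cg.
suff : 'D_1 f x * (y - x) <= f y - f x by lra.
apply: (@ler_cvg_to _ _ _ _ _ _ _ _ cg (cvg_cst (f y - f x))).
near=> h.
have h0 : 0 < h by [].
have h1 : h < 1.
  near: h; apply: nbhs_right_lt; exact: ltr01.
rewrite /g /GRing.scale /= mulr1 addr0 mul0r addr0 mulrC ler_pdivrMr//.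
have := fc y x h y0 x0; rewrite eq_sym => /(_ xy h0 h1).
have -> : h * y + (1 - h) * x = x + h * (y - x) by ring.
lra.
Unshelve. all: by end_near. Qed.

Lemma probability_fineE dsp (T : measurableType dsp) (R : realType)
    (P : probability T R) (A : set T) : measurable A -> P A = (fine (P A))%:E.
Proof. by move=> mA; rewrite fineK// fin_num_measure. Qed.

Lemma fine_probability_setC dsp (T : measurableType dsp) (R : realType)
    (P : probability T R) (A : set T) : measurable A ->
  fine (P (~` A)) = 1 - fine (P A).
Proof.
by move=> mA; rewrite probability_setC// [X in (_ - X)%E]probability_fineE.
Qed.

Lemma sum_measure_bigcup dsp (T : measurableType dsp) (R : realType)
    (mu : {measure set T -> \bar R}) (I : finType) (F : I -> set T) :
  (forall i, measurable (F i)) -> trivIset setT F ->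
  (\sum_i mu (F i) = mu (\bigcup_i F i))%E.
Proof.
move=> mF tF; rewrite (@bigfs _ _ _ _ _ xpredT) ?index_enum_uniq//; last first.
  by move=> i _; rewrite mem_index_enum.
by rewrite set_true measure_fin_bigcup//; exact: finite_finset.
Qed.

(** * Densities and divergences of translates *)

Section TranslateDivergence.
Context (R : realType) (G : groupType).
Variable eta : probability (discrete G) R.
Hypothesis eta_gt0 : fully_supported eta.
Local Open Scope ereal_scope.
Local Open Scope charge_scope.
Implicit Types (g x : discrete G) (A : set (discrete G)).

Let RN g : discrete G -> \bar R :=
  'd (charge_of_finite_measure (translate g eta)) '/d eta.

(** A nonempty set contains an atom of positive mass, so the only [eta]-null set is empty. *)
Lemma dominates_fully_supported (nu : probability (discrete G) R) :
  charge_of_finite_measure nu `<< eta.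
Proof.
apply/null_content_dominatesP => A mA A0.
have -> : A = set0.
  apply/eqP; apply: contraT => /set0P[x Ax].
  have := eta_gt0 x; rewrite ltNge -A0 le_measure ?inE// => y ->//.
exact: measure0.
Qed.

(** Integrating the density over the atom [[set x]] determines its value at every point, not only
    almost everywhere. *)
Lemma translate_densityE g x :
  RN g x = (fine (eta [set (g^-1 * x)%g]) / fine (eta [set x]))%:E.
Proof.
have dom := dominates_fully_supported (translate g eta).
have : translate g eta [set x] = \int[eta]_(y in [set x]) RN g y.
  exact: (Radon_Nikodym_integral dom I).
rewrite translate1.
rewrite (eq_integral (cst (RN g x))); last by move=> y /[!inE] ->.
have := Radon_Nikodym_fin_num x dom; rewrite -/(RN g x) => /fineK <-.
rewrite integral_cst//.
rewrite [LHS]probability_fineE// [X in _ * X]probability_fineE// -EFinM.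
case=> ->.
by rewrite mulfK// gt_eqF// -lte_fin -probability_fineE.
Qed.

Let rho g x : R := fine (RN g x).

Lemma translate_density_gt0 g x : (0 < rho g x)%R.
Proof.
rewrite /rho translate_densityE /=.
by apply: divr_gt0; rewrite -lte_fin -probability_fineE.
Qed.

Lemma rho_RN g x : (rho g x)%:E = RN g x.
Proof. by rewrite /rho translate_densityE. Qed.

Lemma integrable_density g A : eta.-integrable A (RN g).
Proof.
apply: (integrableS measurableT) => //.
exact/Radon_Nikodym_integrable/dominates_fully_supported.
Qed.

Lemma integral_affine_density g A (a b : R) :
  \int[eta]_(x in A) (a + b * rho g x)%:E =
  (a * fine (eta A) + b * fine (translate g eta A))%:E.
Proof.
under eq_integral do rewrite EFinD EFinM rho_RN.
have iR := integrable_density g A.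
rewrite integralD//; last 2 first.
- exact: finite_measure_integrable_cst.
- exact: integrableZl.
rewrite integral_cst// integralZl//.
rewrite EFinD !EFinM -!probability_fineE//; congr (_ + _ * _).
have dom := dominates_fully_supported (translate g eta).
exact/esym/(Radon_Nikodym_integral dom I).
Qed.

(** Affine in the density on [A] and on its complement. Nonzero slopes give the tangent minorants of
    the lower bound; zero slopes describe a density with two values. *)
Let aff g A (a b a' b' : R) x : \bar R :=
  (if x \in A then a + b * rho g x else a' + b' * rho g x)%:E.

Lemma integrable_affine_pieces g A (a b a' b' : R) :
  eta.-integrable setT (aff g A a b a' b').
Proof.
apply: (@le_integrable _ _ _ _ _ _ _
  (fun x => (`|a| + `|a'|)%:E + (`|b| + `|b'|)%:E * RN g x)) => //.
  move=> x _; rewrite -rho_RN -EFinM -EFinD /aff !abse_EFin lee_fin.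
  have := translate_density_gt0 g x => r0.
  rewrite [leRHS]ger0_norm; last first.
    by apply: addr_ge0; [|apply: mulr_ge0; [|exact: ltW]]; apply: addr_ge0.
  have nb (c e : R) : (`|c + e * rho g x| <= `|c| + `|e| * rho g x)%R.
    by apply: (le_trans (ler_normD _ _)); rewrite normrM (gtr0_norm r0).
  rewrite mulrDl.
  have := mulr_ge0 (normr_ge0 b) (ltW r0).
  have := mulr_ge0 (normr_ge0 b') (ltW r0).
  have := normr_ge0 a; have := normr_ge0 a'.
  have := nb a b; have := nb a' b'.
  by case: ifP => _; lra.
apply: integrableD => //; first exact: finite_measure_integrable_cst.
by apply: integrableZl => //; exact: integrable_density.
Qed.

Lemma integral_affine_pieces g A (a b a' b' : R) :
  \int[eta]_x aff g A a b a' b' x =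
  (a * fine (eta A) + b * fine (translate g eta A)
   + (a' * fine (eta (~` A)) + b' * fine (translate g eta (~` A))))%:E.
Proof.
rewrite -(setUv A) integral_setU//; last first.
  by rewrite disj_set2E setICr.
rewrite EFinD -!integral_affine_density; congr (_ + _).
  by apply: eq_integral => x xA; rewrite /aff xA.
by apply: eq_integral => x; rewrite in_setC /aff => /negbTE ->.
Qed.

Lemma f_density_translateE (f : R -> R) g x :
  f_density f (translate g eta) eta x = (f (rho g x))%:E.
Proof.
rewrite /f_density -/(RN g x) -/(rho g x) /patch.
by rewrite mem_set//= in_itv/= translate_density_gt0.
Qed.

Lemma f_divergence_ge_affine (f : R -> R) g A (a b a' b' : R) :
  (forall y, 0 < y -> a + b * y <= f y)%R ->
  (forall y, 0 < y -> a' + b' * y <= f y)%R ->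
  (a * fine (eta A) + b * fine (translate g eta A)
   + (a' * fine (eta (~` A)) + b' * fine (translate g eta (~` A))))%:E
  <= f_divergence f (translate g eta) eta.
Proof.
(* In the non-integrable case the divergence is [+oo]; otherwise the pointwise bound is
   integrated. *)
move=> ab ab'; rewrite /f_divergence; case: asboolP => [fi|_]; last exact: leey.
rewrite -integral_affine_pieces; apply: le_integral => //.
  exact: integrable_affine_pieces.
move=> x _; rewrite f_density_translateE lee_fin.
have r0 := translate_density_gt0 g x.
by case: ifP => _; [exact: ab|exact: ab'].
Qed.

Lemma f_divergence_two_valued (f : R -> R) g A (u v : R) :
  (forall x, A x -> rho g x = u) -> (forall x, ~ A x -> rho g x = v) ->
  f_divergence f (translate g eta) eta =
  (f u * fine (eta A) + f v * fine (eta (~` A)))%:E.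
Proof.
move=> Au Av.
have E : f_density f (translate g eta) eta = aff g A (f u) 0 (f v) 0.
  apply/funext => x; rewrite f_density_translateE /aff !mul0r !addr0.
  by case: ifPn => [/set_mem/Au ->|/negP xA] //; rewrite Av // => /mem_set.
rewrite /f_divergence E asboolT; last exact: integrable_affine_pieces.
by rewrite integral_affine_pieces !mul0r !addr0.
Qed.

End TranslateDivergence.

(** * Letters as group elements, and the direction of an end of the tree *)

Section FreeGroupLetters.
Variable A : choiceType.
Implicit Types (a s : letter A) (w : seq (letter A)) (x : free_group A).

Definition fg_letter s : free_group A := @FreeGroup A [:: s] isT.

Lemma fg_letter_inj : injective fg_letter.
Proof. by move=> s t /(congr1 val) []. Qed.

Lemma fg_letterV s : ((fg_letter s)^-1)%g = fg_letter (letter_inv s).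
Proof. exact/val_inj. Qed.

(* The neighbour of w (in the Cayley graph, for left multiplication) towards
   the end ...aaa is obtained by prepending this letter. *)
Definition toward_end a w : letter A :=
  if all (pred1 a) w then a else letter_inv (head a w).

Lemma letter_inv_neq s : letter_inv s != s.
Proof. by case: s => i b; rewrite xpair_eqE eqxx; case: b. Qed.

Lemma letter_inv_inj : injective (@letter_inv A).
Proof. exact: inv_inj (@letter_invK A). Qed.

Lemma letter_inv_eq s t : (letter_inv s == t) = (s == letter_inv t).
Proof. by rewrite -(inj_eq letter_inv_inj) letter_invK. Qed.

(** Of the two endpoints of an edge, exactly one is the parent of the other: [w] is the parent of
    [s :: w] unless [s :: w] is the parent of [w]. *)
Lemma toward_end_cons a s w : reduced (s :: w) ->
  (toward_end a (s :: w) == letter_inv s) = (toward_end a w != s).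
Proof.
rewrite /toward_end /=; case: ifPn => [/andP[/eqP -> ->] _|].
  by rewrite eq_sym (negbTE (letter_inv_neq a)) eqxx.
rewrite eqxx; case: ifP => [_|]; first by rewrite andbT eq_sym => ->.
by case: w => [//|z w] _ _ /andP[zs _] /=; rewrite letter_inv_eq.
Qed.

Lemma toward_end_lcons a s w : reduced w ->
  (toward_end a (lcons s w) == letter_inv s) = (toward_end a w != s).
Proof.
case: w => [_|y w wr /=]; first exact: toward_end_cons.
case: ifPn => [/eqP ys|ys]; last by apply: toward_end_cons; rewrite /= ys.
(* If [s] cancels the head, the same edge is traversed backwards, from [y :: w] to [w]. *)
have := toward_end_cons a wr; rewrite ys letter_invK => ->.
by rewrite negbK.
Qed.

Lemma fg_letter_mul s x : fg_word (fg_letter s * x)%g = lcons s x.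
Proof. by []. Qed.

End FreeGroupLetters.

(** * Entropy as a finite sum, and the lower bound *)

Section Entropy.
Context (R : realType) (d : nat) (lambda : probability (discrete (F_ d)) R).
Hypothesis lambda_unif : symmetric_uniform lambda.
Variables (eta : probability (discrete (F_ d)) R) (f : R -> R).
Hypothesis eta_gt0 : fully_supported eta.
Local Open Scope ereal_scope.

Lemma symmetric_generatorP (g : F_ d) :
  symmetric_generator g <-> exists s : letter 'I_d, g = fg_letter s.
Proof.
split=> [[i [->|->]]|[[i [|]] ->]].
- by exists (i, true).
- by exists (i, false); rewrite (fg_letterV (i, true)).
- by exists i; left.
- by exists i; right; rewrite (fg_letterV (i, true)).
Qed.

(** [lambda] is carried by the image of the letters, on which [fg_letter] is injective;
    nonnegativity turns the [\esum] into a finite sum. *)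
Lemma h_entropy_sum :
  (forall g : F_ d, 0 <= f_divergence f (translate g eta) eta) ->
  h_entropy lambda f eta =
  \sum_(s : 'I_d * bool)
    ((2 * d%:R)^-1)%:E *
    f_divergence f (translate (fg_letter s : F_ d) eta) eta.
Proof.
move=> D0.
pose D g := f_divergence f (translate g eta) eta.
have k0 : (0 <= (2 * d%:R)^-1 :> R)%R by rewrite invr_ge0 mulr_ge0.
have -> : h_entropy lambda f eta =
    \esum_(g in (fun s : 'I_d * bool => fg_letter s : discrete (F_ d)) @` setT)
      ((2 * d%:R)^-1)%:E * D g.
  rewrite [RHS]esum_mkcond; apply: eq_esum => g _.
  rewrite lambda_unif; case: asboolP => [/symmetric_generatorP[s ->]|ng].
    by rewrite mem_set//; exists s.
  rewrite memNset ?mul0e// => -[s _ gs]; apply: ng.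
  by apply/symmetric_generatorP; exists s.
rewrite esum_image; last by move=> s t _ _ /fg_letter_inj.
rewrite esum_fset; last 2 first.
- exact: finite_finset.
- by move=> s _; apply: mule_ge0 => //; exact: D0.
rewrite [RHS](@bigfs _ _ _ _ _ xpredT) ?index_enum_uniq//; last first.
  by move=> i _; rewrite mem_index_enum.
by rewrite set_true.
Qed.

Local Close Scope ereal_scope.

Hypothesis f_convex : strictly_convex_on_pos f.
Hypothesis f_smooth : smooth_on_pos f.

Let tangent (x : R) : 0 < x ->
  {b : R | forall y, 0 < y -> f x - b * x + b * y <= f y}.
Proof.
move=> x0; exists ('D_1 f x) => y y0; apply: tangent_line_le => //.
exact: (@f_smooth 0%N).
Qed.

(** The tangent of [f] at 1 integrates to [f 1 = 0], since [eta] and its translate have equal total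
    mass. *)
Lemma f_divergence_translate_ge0 (f1 : f 1 = 0) (g : F_ d) :
  (0 <= f_divergence f (translate g eta) eta)%E.
Proof.
have [b fb] := tangent ltr01.
have := f_divergence_ge_affine eta_gt0 g setT fb fb.
apply: le_trans.
by rewrite setCT !measure0 !probability_setT f1 lee_fin /=; lra.
Qed.

Let q : R := 2 * d%:R - 1.

Lemma sum_letter_inv (F : 'I_d * bool -> R) :
  \sum_s F (letter_inv s) = \sum_s F s.
Proof.
rewrite [RHS](reindex_inj (h := fun s : 'I_d * bool => letter_inv s))//.
exact: letter_inv_inj.
Qed.

Lemma sum_letter_const (c : R) : \sum_(s : 'I_d * bool) c = 2 * d%:R * c.
Proof.
rewrite sumr_const card_prod card_ord card_bool -[LHS]mulr_natl natrM.
by rewrite [_%:R * 2]mulrC.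
Qed.

Lemma h_entropy_ge (hd : (2 <= d)%N) (f1 : f 1 = 0) :
  (((2 * d%:R)^-1 * (q * f (1 / q) + f q))%:E <= h_entropy lambda f eta)%E.
Proof.
rewrite h_entropy_sum; last exact: f_divergence_translate_ge0.
have d2 : 2 <= d%:R :> R by rewrite ler_nat.
have q0 : 0 < q by rewrite /q; lra.
have qi0 : 0 < 1 / q by rewrite divr_gt0.
have [b fb] := tangent q0; have [b' fb'] := tangent qi0.
(* The letter [a] selects the end [...aaa]. *)
have a : letter 'I_d := (Ordinal (ltnW hd), true).
(* [P s] consists of the vertices [x] with parent [s x]; these sets partition the group. *)
pose P s : set (discrete (F_ d)) := [set x | toward_end a (fg_word x) = s].
pose m (s : 'I_d * bool) := fine (eta (P s)).
have m1 : \sum_s m s = 1.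
  apply: EFin_inj; rewrite -sumEFin.
  under eq_bigr do rewrite /m -probability_fineE//.
  rewrite sum_measure_bigcup//; last first.
    by move=> s t _ _ [x [<- <-]].
  rewrite (_ : \bigcup_i _ = setT); first exact: probability_setT.
  by apply/seteqP; split=> // x _; exists (toward_end a (fg_word x)).
(* The translate by [s] gives [P (letter_inv s)] the [eta]-mass of the [x] that are parents of
   [s x]. By the edge dichotomy these are the [x] outside [P s]. *)
have transP s :
    fine (translate (fg_letter s : F_ d) eta (P (letter_inv s))) = 1 - m s.
  rewrite -fine_probability_setC//; congr (fine (eta _)).
  apply/seteqP; split => x /=.
    by rewrite /P /= => /eqP; rewrite toward_end_lcons ?(valP x)// => /eqP.
  by rewrite /P /= => /eqP; rewrite -toward_end_lcons ?(valP x)// => /eqP.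
have transPC s :
    fine (translate (fg_letter s : F_ d) eta (~` P (letter_inv s))) = m s.
  by rewrite fine_probability_setC// transP subKr.
pose k : R := (2 * d%:R)^-1.
pose u s : R := (f q - b * q) * m (letter_inv s) + b * (1 - m s) +
  ((f (1 / q) - b' * (1 / q)) * (1 - m (letter_inv s)) + b' * m s).
apply: (@le_trans _ _ (\sum_(s : 'I_d * bool) (k * u s)%:E)%E); last first.
  apply: lee_sum => s _; rewrite EFinM lee_pmul2l//; last first.
    by rewrite lte_fin invr_gt0; lra.
  have := f_divergence_ge_affine eta_gt0 (fg_letter s : F_ d)
    (P (letter_inv s)) fb fb'.
  by rewrite transP transPC fine_probability_setC.
rewrite sumEFin lee_fin -mulr_sumr -/k.
(* As the [m s] add up to 1, the slope [b] gets the coefficient [- q + (2 d - 1) = 0] and [b'] gets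
   [- (1 / q) (2 d - 1) + 1 = 0]. *)
rewrite /u !big_split /= -!mulr_sumr !sumrB !sum_letter_const.
rewrite !(sum_letter_inv m) m1 !mulr1 -/q le_eqVlt; apply/orP; left; apply/eqP.
by rewrite /k; field; rewrite /q in q0 *; lra.
Qed.

End Entropy.

(** * Probability measures from mass functions *)

Section MassFunction.
Context (R : realType) (G : groupType) (w : G -> R).
Hypothesis w_ge0 : forall x, 0 <= w x.
Hypothesis w_sum1 : (\esum_(x in [set: G]) (w x)%:E = 1)%E.
Local Open Scope ereal_scope.

(* The hypotheses are arguments so that the probability structure on this
   function can be inferred from the term. *)
Definition mass_measure of (forall x, 0 <= w x)%R
    & \esum_(x in [set: G]) (w x)%:E = 1 :=
  fun A : set (discrete G) => \esum_(x in A) (w x)%:E.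

Local Notation mu := (mass_measure w_ge0 w_sum1).

Let mu0 : mu set0 = 0. Proof. exact: esum_set0. Qed.

Let mu_ge0 A : 0 <= mu A.
Proof. by apply: esum_ge0 => x _; rewrite lee_fin. Qed.

Let mu_sigma_additive : semi_sigma_additive mu.
Proof.
move=> F _ tF _; rewrite /mass_measure nneseries_sum_bigcup//.
by apply: is_cvg_nneseries => n _ _; exact: mu_ge0.
Qed.

HB.instance Definition _ :=
  isMeasure.Build _ _ _ mu mu0 mu_ge0 mu_sigma_additive.

Let mu_setT : mu setT = 1. Proof. exact: w_sum1. Qed.

HB.instance Definition _ := Measure_isProbability.Build _ _ _ mu mu_setT.

Lemma mass_function_probability :
  exists P : probability (discrete G) R, forall x, P [set x] = (w x)%:E.
Proof. by exists mu => x; rewrite /= /mass_measure esum_set1 ?lee_fin. Qed.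

End MassFunction.

(** * Counting reduced words by length *)

Section Spheres.
Context (d : nat) (hd : (2 <= d)%N) (R : realType).
Local Notation FG := (free_group 'I_d).
Implicit Types x : FG.

Let q : R := 2 * d%:R - 1.

(** Only the inverse of the first letter, if there is one, cannot be prepended. *)
Lemma card_extension x :
  #|[pred s : 'I_d * bool | reduced ((s : letter 'I_d) :: fg_word x)]| =
  if fg_word x is [::] then (2 * d)%N else (2 * d).-1.
Proof.
have L : #|{: 'I_d * bool}| = (2 * d)%N.
  by rewrite card_prod card_bool card_ord mulnC.
case: x => w wr /=; case: w wr => [|y w] wr /=; rewrite -L.
  by apply: eq_card => s; rewrite !inE.
rewrite -(cardC1 (letter_inv y : 'I_d * bool)); apply: eq_card => s.
rewrite !inE /= (_ : path _ y w = true) ?andbT; last exact: wr.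
by rewrite eq_sym letter_inv_eq.
Qed.

Local Open Scope ereal_scope.

Definition sphere n : set FG := [set x | size (fg_word x) = n].

(** A reduced word of length [n.+1] arises from exactly one pair of a word of length [n] and a
    letter that does not cancel against it. *)
Lemma esum_sphereS n (c : R) : (0 <= c)%R ->
  \esum_(x in sphere n.+1) c%:E =
  \esum_(x in sphere n) ((if n is 0 then 2 * d else (2 * d).-1)%:R * c)%:E.
Proof.
move=> c0.
pose J x :=
  [set` [pred s : 'I_d * bool | reduced ((s : letter 'I_d) :: fg_word x)]].
pose e (k : FG * ('I_d * bool)) : FG := (fg_letter k.2 * k.1)%g.
rewrite (@reindex_esum _ _ _ (sphere n `*`` J) _ e).
  rewrite -(@esum_esum _ _ _ _ _ (fun _ _ => c%:E)); last first.
    by move=> *; rewrite lee_fin.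
  apply: eq_esum => x xn; rewrite esum_fset; last 2 first.
  - exact: finite_finset.
  - by move=> *; rewrite lee_fin.
  rewrite -[LHS](@bigfs _ _ _ _ (index_enum ('I_d * bool)%type))
    ?index_enum_uniq//; last first.
    by move=> i _; rewrite mem_index_enum.
  rewrite sumEFin sumr_const -[in LHS]mulr_natl card_extension.
  by move: xn; rewrite /sphere /=; case: (fg_word x) => [|? ?] /= <-.
have eE k : J k.1 k.2 -> fg_word (e k) = k.2 :: fg_word k.1.
  rewrite /J /e /= => kr; case: (fg_word k.1) kr => [//|y w] /=.
  by case/andP=> /negbTE ->.
split.
- move=> k [kn kJ]; rewrite -[sphere _ _]/(size (fg_word (e k)) = n.+1).
  by rewrite eE//= kn.
- move=> [x s] [y t] /set_mem[/= _ xs] /set_mem[/= _ yt] /(congr1 (@fg_word _)).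
  by rewrite (eE (x, s))// (eE (y, t))//= => -[-> /val_inj ->].
- case=> -[//|s w] wr [wn].
  have wr' : reduced w by exact: path_sorted wr.
  exists (FreeGroup wr', s); first by split.
  exact/val_inj/(eE (FreeGroup wr', s)).
Qed.

Lemma esum_sphere n (c : R) : (0 <= c)%R ->
  \esum_(x in sphere n) c%:E =
  (if n is m.+1 then (q + 1) * q ^+ m * c else c)%:E.
Proof.
have qE : ((2 * d).-1%:R = q :> R)%R.
  by rewrite -subn1 natrB ?natrM// muln_gt0 (ltnW hd).
have q1E : ((2 * d)%:R = q + 1 :> R)%R by rewrite natrM /q subrK.
have q0 : (0 <= q)%R by rewrite -qE.
(* The constant [c] stays general because each step absorbs the number of extensions into it. *)
elim: n c => [|n IH] c c0.
  rewrite (_ : sphere 0 = [set fg_one _]) ?esum_set1 ?lee_fin//.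
  apply/seteqP; split=> [x /size0nil x1|_ ->//]; exact: val_inj.
rewrite esum_sphereS// IH; last by rewrite mulr_ge0.
case: n {IH} => [|n]; first by rewrite q1E expr0 mulr1.
by rewrite qE exprSr; congr _%:E; ring.
Qed.

End Spheres.

(** * The measures with geometric decay in word length *)

Section GeometricMeasure.
Context (d : nat) (hd : (2 <= d)%N) (R : realType).
Let q : R := 2 * d%:R - 1.
Variable r : R.
Hypotheses (r0 : 0 < r) (qr1 : q * r < 1).

(** The normalising constant: [1 / c = 1 + (q + 1) r / (1 - q r)], summed over spheres. *)
Let c : R := (1 - q * r) / (1 + r).

Let c0 : 0 < c. Proof. by rewrite divr_gt0 ?subr_gt0 ?addr_gt0. Qed.

Lemma esum_geometric :
  (\esum_(x in [set: F_ d]) (c * r ^+ size (fg_word x))%:E = 1)%E.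
Proof.
rewrite (_ : [set: _] = \bigcup_n @sphere d n); last first.
  by apply/seteqP; split => // x _; exists (size (fg_word x)).
rewrite nneseries_sum_bigcup; last 2 first.
- by move=> m n _ _ [x [<- <-]].
- by move=> x; rewrite lee_fin mulr_ge0 ?exprn_ge0 ?ltW.
have wn n : (0 <= c * r ^+ n) by rewrite mulr_ge0 ?exprn_ge0 ?ltW.
pose u n : \bar R :=
  (if n is m.+1 then (q + 1) * q ^+ m * (c * r ^+ n) else (c * r ^+ n))%:E.
rewrite (eq_eseriesr (g := u)); last first.
  move=> n _; have <- : _ = u n := esum_sphere hd n (wn n).
  by apply: eq_esum => x <-.
have r1 : 1 + r != 0 by rewrite gt_eqF// addr_gt0.
(* Closed form of the partial sums; the error term tends to 0 because [0 <= q r < 1]. *)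
have S n : (\sum_(0 <= i < n.+1) u i =
    (1 - (q + 1) * r / (1 + r) * (q * r) ^+ n)%:E)%E.
  elim: n => [|n IH].
    rewrite big_nat1 /u expr0 !mulr1 /c; congr _%:E; field; exact: r1.
  rewrite big_nat_recr//= IH /u -EFinD; congr _%:E.
  rewrite /c !exprMn !exprS; field; exact: r1.
apply/cvg_lim => //; rewrite -cvg_shiftS.
under eq_fun do rewrite /= S.
apply: cvg_EFin; first by near=> n.
have qr0 : 0 <= q * r.
  by apply: mulr_ge0 (ltW r0); rewrite subr_ge0 -natrM ler1n muln_gt0 (ltnW hd).
rewrite -[X in _ --> X]subr0 -[X in _ --> _ - X](mulr0 ((q + 1) * r / (1 + r))).
apply: cvgB; first exact: cvg_cst.
apply: cvgM; first exact: cvg_cst.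
by apply: cvg_expr; rewrite ger0_norm.
Unshelve. all: by end_near. Qed.

End GeometricMeasure.

Lemma h_entropy_geometric (R : realType) (d : nat) (hd : (2 <= d)%N)
    (lambda : probability (discrete (F_ d)) R) (f : R -> R) (r : R) :
  symmetric_uniform lambda -> smooth_on_pos f -> strictly_convex_on_pos f ->
  f 1 = 0 -> 0 < r -> (2 * d%:R - 1) * r < 1 ->
  exists2 eta : probability (discrete (F_ d)) R, fully_supported eta &
    let c := (1 - (2 * d%:R - 1) * r) / (1 + r) in
    h_entropy lambda f eta =
    ((2 * d%:R)^-1 * (f r^-1 * (1 - c) + f r * (2 * d%:R - (1 - c))))%:E.
Proof.
move=> lu fs fc f1 r0 qr1.
pose c := (1 - (2 * d%:R - 1) * r) / (1 + r).
have c0 : 0 < c by rewrite divr_gt0 ?subr_gt0 ?addr_gt0.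
pose w (x : F_ d) := c * r ^+ size (fg_word x).
have w0 x : 0 < w x by rewrite mulr_gt0 ?exprn_gt0.
have [eta etaE] := mass_function_probability (fun x => ltW (w0 x))
  (esum_geometric hd r0 qr1).
have eta0 : fully_supported eta by move=> g; rewrite etaE lte_fin.
exists eta => //= ; rewrite -/c.
rewrite (h_entropy_sum lu); last exact: f_divergence_translate_ge0.
(* The words starting with [s]. Together they cover everything but the identity, whose mass is [c],
   so their masses add up to [1 - c]. *)
pose A s : set (discrete (F_ d)) := [set x | ohead (fg_word x) = Some s].
pose m (s : 'I_d * bool) := fine (eta (A s)).
have m1 : \sum_s m s = 1 - c.
  apply: EFin_inj; rewrite -sumEFin.
  under eq_bigr do rewrite /m -probability_fineE//.
  rewrite sum_measure_bigcup//; last first.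
    by move=> s t _ _ [x []]; rewrite /A /= => -> [].
  rewrite (_ : \bigcup_i _ = ~` [set 1%g]).
    transitivity (fine (eta (~` [set 1%g])))%:E; first exact: probability_fineE.
    by rewrite fine_probability_setC// etaE /w /= mulr1.
  apply/seteqP; split=> [x [s _ + x1]|x /eqP]; first by rewrite /A /= x1.
  case: x => -[|s x] xr x1; last by exists s.
  by exfalso; move/eqP: x1; apply; exact: val_inj.
have D (s : 'I_d * bool) :
    f_divergence f (translate (fg_letter s : F_ d) eta) eta =
    (f r^-1 * m s + f r * (1 - m s))%:E.
  have shift x :
      fine (eta [set ((fg_letter s : F_ d)^-1 * x)%g]) / fine (eta [set x]) =
      r ^+ size (lcons (letter_inv s) (fg_word x)) / r ^+ size (fg_word x).
    rewrite !etaE /= /w fg_letterV fg_letter_mul.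
    by rewrite -mulf_div divff ?mul1r// gt_eqF.
  have rn0 n : r ^+ n != 0 by rewrite expf_neq0// gt_eqF.
  (* Multiplying by the inverse of [s] shortens the words in [A s] by one letter and lengthens all
     others by one. *)
  rewrite (@f_divergence_two_valued _ _ _ eta0 _ _ (A s) r^-1 r).
  - by rewrite fine_probability_setC.
  - move=> x xs; rewrite translate_densityE//= shift.
    move: xs; rewrite /A /=; case: (fg_word x) => // t v [->] /=.
    by rewrite letter_invK eqxx exprS invfM mulrCA divff ?mulr1.
  - move=> x xs; rewrite translate_densityE//= shift.
    rewrite (_ : lcons _ _ = letter_inv s :: fg_word x) /= ?exprS ?mulfK//.
    move: xs; rewrite /A /=; case: (fg_word x) => // t v ts /=.
    by rewrite letter_invK; case: eqP => // ts'; case: ts; rewrite /= ts'.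
under eq_bigr do rewrite D -EFinM.
rewrite sumEFin -mulr_sumr big_split /= -!mulr_sumr sumrB sum_letter_const m1.
by rewrite mulr1.
Qed.

Theorem theoremD (R : realType) (d : nat) (hd : (2 <= d)%N)
    (lambda : probability (discrete (F_ d)) R)
    (hlambda : symmetric_uniform lambda)
    (f : R -> R) (f_smooth : smooth_on_pos f)
    (f_convex : strictly_convex_on_pos f) (f1 : f 1 = 0) :
  I_entropy lambda f =
  ((2 * d%:R - 1) / (2 * d%:R) * f (1 / (2 * d%:R - 1))
   + 1 / (2 * d%:R) * f (2 * d%:R - 1))%:E.
Proof.
set q : R := 2 * d%:R - 1; pose k : R := (2 * d%:R)^-1.
have d2 : 2 <= d%:R :> R by rewrite ler_nat.
have q0 : 0 < q by rewrite /q; lra.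
have dE : 2 * d%:R = q + 1 :> R by rewrite /q subrK.
have fcont x : 0 < x -> {for x, continuous f}.
  move=> x0; apply: differentiable_continuous; apply/derivable1_diffP.
  exact: (@f_smooth 0%N).
have -> : q / (2 * d%:R) * f (1 / q) + 1 / (2 * d%:R) * f q =
    k * (q * f (1 / q) + f q) by rewrite /k; ring.
apply/eqP; rewrite eq_le; apply/andP; split; last first.
  apply/ereal_infP => _ [eta eta0 <-].
  exact: h_entropy_ge.
pose c r := (1 - q * r) / (1 + r).
pose H r := k * (f r^-1 * (1 - c r) + f r * (2 * d%:R - (1 - c r))).
have qi0 : 0 < q^-1 by rewrite invr_gt0.
(* At [r = 1 / q] the constant [c r] vanishes, so [H] takes the value of the lower bound there,
   although no measure corresponds to this [r]. *)
have Hq : H q^-1 = k * (q * f (1 / q) + f q).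
  rewrite /H /c invrK mulfV ?gt_eqF// subrr mul0r subr0 dE div1r; ring.
(* The limit is taken from the left, since the geometric measure requires [q r < 1]. *)
have cH : H r @[r --> q^-1^'-] --> k * (q * f (1 / q) + f q).
  rewrite -Hq; apply: cvg_at_left_filter.
  have cc : c r @[r --> q^-1] --> c q^-1.
    apply: cvgM.
      apply: cvgB; first exact: cvg_cst.
      by apply: cvgM; [exact: cvg_cst|exact: cvg_id].
    apply: cvgV; first by rewrite gt_eqF// addr_gt0.
    by apply: cvgD; [exact: cvg_cst|exact: cvg_id].
  apply: cvgM; first exact: cvg_cst.
  have c1 : 1 - c r @[r --> q^-1] --> 1 - c q^-1.
    by apply: cvgB => //; exact: cvg_cst.
  apply: cvgD; apply: cvgM => //.
  - apply: continuous_comp; last by apply: fcont; rewrite invrK.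
    by apply: cvgV; [rewrite gt_eqF|exact: cvg_id].
  - exact: fcont.
  - by apply: cvgB => //; exact: cvg_cst.
(* For each [e > 0], some [r] slightly below [1 / q] gives a measure with entropy within [e] of the
   bound. *)
apply/lee_addgt0Pr => e e0.
have := cvgr_le _ cH (k * (q * f (1 / q) + f q) + e).
rewrite ltrDl => /(_ _ e0) nearH.
near (q^-1^'-) => r.
have r0 : 0 < r by near: r; exact: nbhs_left_gt.
have qr : q * r < 1.
  by rewrite mulrC -ltr_pdivlMr// div1r.
have [eta eta0 /= hE] :=
  h_entropy_geometric hd hlambda f_smooth f_convex f1 r0 qr.
apply: (@le_trans _ _ (h_entropy lambda f eta)).
  by apply: ereal_inf_lbound; exists eta.
rewrite hE -EFinD lee_fin -/q -/k -/(c r) -/(H r).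
near: r; exact: nearH.
Unshelve. all: by end_near. Qed.
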